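(* Let $K$ be an algebraically closed field of characteristic $0$ and let $S = K[x_0,\ldots,x_n]$. Let $J \subseteq S$ be an ideal that is extremal with respect to a term ordering $>$, let $m$ be the largest degree of a minimal generator of $J$, and let $r = \dim_K J_m$. Let $V \subseteq S_m$ be a $K$-subspace of dimension $r$, and let $I = (V) \subseteq S$ be the ideal generated by the elements of $V$. If $[V] \in \mathscr{W}_{[J_m]} \subseteq \operatorname{G}(r, S_m)$, then $$\dim_K I_{m+1} = \dim_K J_{m+1} \iff \dim_K I_z = \dim_K J_z \ \text{ for all } z \geq m.$$
   Context: $S = K[x_0,\ldots,x_n]$ has its standard grading, $S_d$ is the space of homogeneous polynomials of degree $d$, and for a homogeneous ideal $I$, $I_d = I \cap S_d$. A monomial is written $\mathbf{x}^A = x_0^{a_0}\cdots x_n^{a_n}$ for an exponent vector $A=(a_0,\ldots,a_n)$. A term ordering is a monomial order on $S$ (a total order on monomials, compatible with multiplication, with $1$ smallest). Borel-fixed ideal: a monomial ideal $I \subseteq S$ such that $x_i\mathbf{x}^A \in I$ implies $x_{i-1}\mathbf{x}^A \in I$, for every monomial $\mathbf{x}^A$ and every $i$ with $0 < i \le n$. Extremal ideal: let $J$ be a Borel-fixed ideal and let $m$ be the largest degree of any minimal generator of $J$. Then $J$ is extremal with respect to the term ordering $>$ if the monomials in $J_m$ are the largest monomials of degree $m$ with respect to $>$, i.e. every monomial of degree $m$ in $J$ is $>$ every monomial of degree $m$ not in $J$. Grassmannian and chart: $\operatorname{G}(r, S_m)$ is the Grassmannian of $r$-dimensional $K$-subspaces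 of $S_m$, and $[V]$ denotes the point corresponding to a subspace $V$. $\mathscr{W}_{[J_m]}$ is the standard affine open chart of $\operatorname{G}(r,S_m)$ with origin $[J_m]$, taken with respect to the monomial basis of $S_m$ (which extends the monomial basis of $J_m$): it is the set of $[V]$ whose Plücker coordinate corresponding to the wedge of the monomials in $J_m$ is nonzero. Equivalently, $V$ has a (unique) basis of the form $\mathbf{x}^A + \sum_{B} c_{AB}\mathbf{x}^B$, one element for each degree-$m$ monomial $\mathbf{x}^A \in J$, where $\mathbf{x}^B$ runs over the degree-$m$ monomials not in $J$ and $c_{AB} \in K$. *)

(* Defs.v *)
From mathcomp Require Import all_boot all_order all_algebra.
From mathcomp Require Export mpoly.
From Stdlib Require Import ClassicalEpsilon.

Set Implicit Arguments.
Unset Strict Implicit.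
Unset Printing Implicit Defensive.

Import GRing.Theory.
Local Open Scope ring_scope.

Section Ideals.
Variables (K : fieldType) (n : nat).
Local Notation S := {mpoly K[n.+1]}.
Local Notation mon := 'X_{1..n.+1}.

Definition ideal (I : S -> Prop) : Prop :=
  [/\ I 0, (forall f g, I f -> I g -> I (f + g))
    & forall h f, I f -> I (h * f)].

Definition ideal_gen (G : S -> Prop) : S -> Prop := fun f =>
  exists s : seq (S * S),
    (forall p, p \in s -> G p.2) /\ f = \sum_(p <- s) p.1 * p.2.

Definition mon_gen (M : mon -> Prop) : S -> Prop :=
  ideal_gen (fun f => exists2 A, M A & f = 'X_[A]).

Definition mon_generators (I : S -> Prop) (M : mon -> Prop) : Prop :=
  forall f, I f <-> mon_gen M f.

Definition monomial_ideal (I : S -> Prop) : Prop :=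
  exists M, mon_generators I M.

Definition minimal_mon_generators (I : S -> Prop) (M : mon -> Prop) : Prop :=
  mon_generators I M /\
  forall M' : mon -> Prop, (forall A, M' A -> M A) ->
    mon_generators I M' -> forall A, M A -> M' A.

Definition minimal_generator (I : S -> Prop) (A : mon) : Prop :=
  exists2 M, minimal_mon_generators I M & M A.

Definition max_gen_degree (I : S -> Prop) (m : nat) : Prop :=
  (exists2 A, minimal_generator I A & mdeg A = m) /\
  forall A, minimal_generator I A -> (mdeg A <= m)%N.

Definition Borel_fixed (I : S -> Prop) : Prop :=
  monomial_ideal I /\
  forall (A : mon) (i j : 'I_n.+1), i = j.+1 :> nat ->
    I ('X_i * 'X_[A]) -> I ('X_j * 'X_[A]).

(* [le] is the non-strict order; the built-in order on monomials is one
   particular instance and is deliberately not used. *)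
Definition term_ordering (le : rel mon) : Prop :=
  [/\ [/\ reflexive le, antisymmetric le, transitive le & total le],
      (forall A B C, le A B -> le (A + C)%MM (B + C)%MM)
    & forall A, le 0%MM A].

Definition extremal (le : rel mon) (J : S -> Prop) (m : nat) : Prop :=
  [/\ Borel_fixed J, max_gen_degree J m
    & forall A B, mdeg A = m -> mdeg B = m -> J 'X_[A] -> ~ J 'X_[B] ->
        le B A && (B != A)].

(* The degree-[d] part of [I] as a subspace of [S_d = dhomog n.+1 K d]; it is
   characterized by [homog_partP] whenever [I] is an ideal. *)
Definition homog_part (I : S -> Prop) (d : nat) : {vspace dhomog n.+1 K d} :=
  epsilon (inhabits 0%VS) (fun U : {vspace dhomog n.+1 K d} =>
    forall f : dhomog n.+1 K d, f \in U <-> I (f : S)).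

Definition subspace_ideal d (V : {vspace dhomog n.+1 K d}) : S -> Prop :=
  ideal_gen (fun f => exists2 v : dhomog n.+1 K d, v \in V & f = v :> S).

(* The maximal minor, on the columns [s], of the matrix of coefficients of a
   basis of [V]. It depends on the choice of the basis only up to a nonzero
   scalar, and on the order of [s] only up to sign. *)
Definition plucker d (V : {vspace dhomog n.+1 K d}) (s : (\dim V).-tuple mon) :
    K :=
  \det (\matrix_(i < \dim V, j < \dim V)
          (tnth (vbasis V) i : S)@_(tnth s j)).
Arguments plucker {d} V s.

(* The tuple [s] enumerates the monomials of [J_d], so this forces
   [\dim V = \dim J_d]. *)
Definition in_chart d (J : S -> Prop) (V : {vspace dhomog n.+1 K d}) : Prop :=
  exists s : (\dim V).-tuple mon,
    [/\ uniq s, (forall A, A \in s <-> mdeg A = d /\ J 'X_[A])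
      & plucker V s != 0].

Lemma ideal_gen_ideal (G : S -> Prop) : ideal (ideal_gen G).
Proof.
split.
- by exists [::]; split=> //; rewrite big_nil.
- move=> _ _ [s [sG ->]] [t [tG ->]]; exists (s ++ t); rewrite big_cat; split=> // p.
  by rewrite mem_cat => /orP[/sG|/tG].
- move=> h _ [s [sG ->]]; exists [seq (h * p.1, p.2) | p <- s]; split.
    by move=> _ /mapP[p /sG pG ->].
  by rewrite big_map mulr_sumr; apply: eq_bigr => p _; rewrite mulrA.
Qed.

Lemma subspace_of_closed (W : vectType K) (P : W -> Prop) :
  P 0 -> (forall (a : K) u v, P u -> P v -> P (a *: u + v)) ->
  exists U : {vspace W}, forall w, w \in U <-> P w.
Proof.
move=> P0 PD.
suff H k (U : {vspace W}) : (dim W - \dim U <= k)%N ->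
    (forall w, w \in U -> P w) -> exists U : {vspace W}, forall w, w \in U <-> P w.
  by apply: (H (dim W) 0%VS); [rewrite leq_subr | move=> w; rewrite memv0 => /eqP->].
elim: k U => [|k IHk] U Uk UP.
  exists U => w; split=> [/UP//|_].
  have /eqP-> : U == fullv by rewrite eqEdim subvf dimvf -subn_eq0 -leqn0.
  exact: memvf.
case: (excluded_middle_informative (exists2 w, P w & w \notin U)); last first.
  move=> H; exists U => w; split=> [/UP//|Pw].
  by apply/negPn/negP => wU; apply: H; exists w.
case=> w Pw wU; apply: (IHk (<[w]> + U)%VS); last first.
  by move=> _ /memv_addP[_ /vlineP[a ->] [u uU ->]]; apply: PD => //; apply: UP.
have lt_dim : (\dim U < \dim (<[w]> + U))%N.
  rewrite (ltn_leqif (dimv_leqif_sup (addvSr _ _))).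
  by apply: contra wU => /subvP; apply; rewrite memvE addvSl.
have := leq_sub2l (dim W) lt_dim; rewrite subnS => /leq_trans; apply.
by rewrite -ltnS (leq_trans _ (_ : k.+1 <= k.+1)%N) //; case: (_ - _)%N Uk.
Qed.

Lemma homog_partP (I : S -> Prop) d : ideal I ->
  forall f : dhomog n.+1 K d, f \in homog_part I d <-> I (f : S).
Proof.
case=> I0 ID IM; apply: (epsilon_spec (inhabits 0%VS)
  (fun U : {vspace dhomog n.+1 K d} => forall f, f \in U <-> I (f : S))).
apply: (@subspace_of_closed _ (fun f : dhomog n.+1 K d => I (f : S))).
  by rewrite linear0.
move=> a u v Iu Iv.
have -> : (a *: u + v : dhomog _ _ _) = a%:MP * u + v :> S.
  by rewrite mul_mpolyC linearP.
by apply: ID => //; apply: IM.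
Qed.

Lemma mon_generators_ideal (I : S -> Prop) (M : mon -> Prop) :
  mon_generators I M -> ideal I.
Proof.
move=> IM; have [g0 gD gM] := ideal_gen_ideal (fun f => exists2 A, M A & f = 'X_[A]).
split; first exact/IM.
- by move=> f g /IM If /IM Ig; apply/IM/gD.
- by move=> h f /IM If; apply/IM/gM.
Qed.

End Ideals.

(* Main.v *)
From HB Require Import structures.
Require Import Defs.
From mathcomp Require Import all_boot all_order all_algebra.
From mathcomp Require Import zify.
From Stdlib Require Import ClassicalEpsilon.

Set Implicit Arguments.
Unset Strict Implicit.
Unset Printing Implicit Defensive.

Import GRing.Theory.
Local Open Scope ring_scope.

(** The reduced basis of [V] in the chart consists of polynomials [F A], one for
each monomial [A] of [J_m], equal to [A] plus monomials outside [J]; because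
[J] is extremal, these are smaller than [A].  Let [I] be the ideal generated by
[V] and [N_z] the span of the monomials of degree [z] outside [J].

Rewriting a monomial [C] of [J_z] by means of [F A] for a divisor [A] of [C]
leaves smaller monomials, so rewriting terminates and [I_z + N_z] is everything
([ideal_add_mon_space]); hence [dim I_z >= dim J_z] for every [z >= m].  Equality
holds exactly when [I_z] meets [N_z] trivially, that is, when every element of
[I_z] rewrites to [0].

Suppose equality holds in degree [m+1].  Let [A'] be obtained from [A] by
replacing one variable [x_k] by [x_j] with [j < k], a move that stays in [J]
because [J] is Borel-fixed.  Then [x_j F A - x_k F A'] has no term [x_j A], so it
rewrites to [0] using only multiples of basis elements with leading monomial
below [x_j A] ([linear_syzygy]).  These linear syzygies suffice in all degrees:
for a monomial [M] of [J_z], any divisor of [M] in [J_m] is joined by such moves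
to the divisor of least weight, the weight of a monomial being the sum of the
indices of its variables ([Borel_swap]).  By induction on [M], then on the
weight, all products [x^D F A] with [x^D A = M] therefore lie in the span of one
product per monomial of [J_z] ([multiple_reducible]), so that
[dim I_z <= dim J_z] as well. *)

(** * Homogeneous components and spans of monomials *)

Section HomogeneousComponents.
Variables (K : fieldType) (n : nat).
Local Notation S := {mpoly K[n.+1]}.
Local Notation mon := 'X_{1..n.+1}.

Definition monomials d : seq mon :=
  [seq s2m t | t : d.-tuple 'I_n.+1 <- enum (basis n.+1 d)].

Lemma mem_monomials d A : (A \in monomials d) = (mdeg A == d).
Proof. by rewrite basis_cover. Qed.

Lemma dimv_homog d : \dim {:dhomog n.+1 K d} = size (monomials d).
Proof. by rewrite dimvf mpoly.size_basis. Qed.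

(** Being linear on all polynomials, the projection lets one expand a product
term by term inside a homogeneous component. *)
Definition homog_proj d (p : S) : dhomog n.+1 K d := DHomog (pihomogP mdeg d p).

Lemma homog_proj_is_linear d : linear (@homog_proj d).
Proof. by move=> a p q; apply/val_inj; rewrite /= linearP. Qed.

HB.instance Definition _ d := GRing.isLinear.Build K S (dhomog n.+1 K d) _
  (@homog_proj d) (@homog_proj_is_linear d).

Lemma homog_projE d (p : S) : p \is d.-homog -> homog_proj d p = p :> S.
Proof. exact: pihomog_dE. Qed.

Lemma homog_proj_id d (v : dhomog n.+1 K d) : homog_proj d v = v.
Proof. by apply/val_inj; rewrite /= pihomog_dE //; case: v. Qed.

Lemma homog_proj_neq d e (p : S) : p \is d.-homog -> d != e -> homog_proj e p = 0.
Proof. by move=> pd de; apply/val_inj; rewrite /= (pihomog_ne0 de). Qed.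

Lemma memv_homog_proj d (U : {vspace dhomog n.+1 K d}) (p : S) :
  (forall C, C \in msupp p -> mdeg C = d -> homog_proj d 'X_[C] \in U) ->
  homog_proj d p \in U.
Proof.
move=> pU; rewrite [p]mpolyE linear_sum /= big_seq rpred_sum // => C Cp.
rewrite linearZ rpredZ //=; have [/pU->//|Cd] := eqVneq (mdeg C) d.
by rewrite (@homog_proj_neq (mdeg C)) ?rpred0 ?dhomogX.
Qed.

Lemma span_ind (W : vectType K) (P : W -> Prop) (X : seq W) :
  P 0 -> (forall (a : K) u v, P u -> P v -> P (a *: u + v)) ->
  (forall w, w \in X -> P w) -> forall w, w \in <<X>>%VS -> P w.
Proof.
move=> P0 PD PX w /(@coord_span _ _ _ (in_tuple X))->.
elim/big_ind: _ => // [u v Pu Pv|i _]; first by rewrite -[u]scale1r; exact: PD.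
by rewrite -[_ *: _]addr0; apply: PD => //; apply/PX/mem_nth.
Qed.

Definition mon_space (Q : pred mon) d : {vspace dhomog n.+1 K d} :=
  <<[seq homog_proj d 'X_[C] | C <- monomials d & Q C]>>.

Lemma mem_mon_space (Q : pred mon) d A :
  mdeg A = d -> Q A -> homog_proj d 'X_[A] \in mon_space Q d.
Proof.
move=> Ad QA; apply/memv_span/map_f.
by rewrite mem_filter QA mem_monomials Ad eqxx.
Qed.

Lemma dim_span_monomials (Q : pred mon) d (g : mon -> dhomog n.+1 K d) :
  (\dim <<[seq g C | C <- monomials d & Q C]>>%VS <= count Q (monomials d))%N.
Proof. by apply: leq_trans (dim_span _) _; rewrite size_map size_filter. Qed.

(** The monomials outside [Q] span a space of codimension at least the number of
monomials in [Q].  Counting dimensions in the sum bounds [U] from below, and if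
the bound is attained nothing is left for the intersection. *)
Lemma dim_add_mon_spaceC (Q : pred mon) d (U : {vspace dhomog n.+1 K d}) :
  (U + mon_space (predC Q) d = fullv)%VS ->
  (count Q (monomials d) <= \dim U)%N /\
  (\dim U = count Q (monomials d) -> (U :&: mon_space (predC Q) d = 0)%VS).
Proof.
move=> UN; have := dimv_sum_cap U (mon_space (predC Q) d).
rewrite UN dimv_homog -(count_predC Q) => dimE.
have dimN := dim_span_monomials (predC Q) (fun C => homog_proj d 'X_[C]).
rewrite -/(mon_space _ _) in dimN.
move: dimE dimN (dimv_eq0 (U :&: mon_space (predC Q) d)).
move: (\dim _) (\dim _) (\dim _) (count _ _) (count _ _) => a b c e f.
move=> dimE dimN cap0; split=> [|dimU]; first by lia.
by apply/eqP; rewrite -cap0; lia.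
Qed.

Lemma dim_mon_space (Q : pred mon) d :
  \dim (mon_space Q d) = count Q (monomials d).
Proof.
apply/eqP; rewrite eqn_leq dim_span_monomials /=.
suff /dim_add_mon_spaceC[] :
  (mon_space Q d + mon_space (predC Q) d = fullv)%VS by [].
apply/eqP; rewrite eqEsubv subvf; apply/subvP => w _.
rewrite -[w]homog_proj_id; apply: memv_homog_proj => C _ Cd.
have [QC|QC] := boolP (Q C).
  by apply: (subvP (addvSl _ _)); apply: mem_mon_space.
by apply: (subvP (addvSr _ _)); apply: mem_mon_space.
Qed.

End HomogeneousComponents.

(** * Term orders *)

Section TermOrders.
Variables (n : nat) (le : rel 'X_{1..n.+1}).
Hypothesis le_ordering : term_ordering le.
Local Notation mon := 'X_{1..n.+1}.

Definition term_lt : rel mon := fun A B => le A B && (A != B).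

Lemma term_ltW A B : term_lt A B -> le A B.
Proof. by case/andP. Qed.

Lemma term_lt_le_trans A B C : term_lt A B -> le B C -> term_lt A C.
Proof.
case: le_ordering => -[_ anti tr _] _ _ /andP[AB neAB] BC.
apply/andP; split; first exact: tr BC.
by apply: contraNneq neAB => eqAC; apply/eqP/anti; rewrite AB eqAC.
Qed.

Lemma term_ltD2r A B C : term_lt A B -> term_lt (A + C)%MM (B + C)%MM.
Proof.
case: le_ordering => _ leD _ /andP[AB neAB].
by rewrite /term_lt leD //= eqm_add2r.
Qed.

(** There are finitely many monomials of degree [d], so a term order is well
founded on them: the number of smaller ones serves as a rank. *)
Lemma term_lt_ind d (P : mon -> Prop) :
  (forall B, mdeg B = d ->
     (forall C, mdeg C = d -> term_lt C B -> P C) -> P B) ->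
  forall B, mdeg B = d -> P B.
Proof.
move=> IH.
pose rank B := count (term_lt^~ B) (monomials n d).
suff H k : forall B, (rank B < k)%N -> mdeg B = d -> P B.
  by move=> B; apply: (H (rank B).+1).
elim: k => // k IHk B Bk Bd; apply: (IH _ Bd) => C Cd CB; apply: IHk => //.
apply: (@leq_trans (rank B)) => //; rewrite /rank.
have := count_predUI (term_lt^~ C) (pred1 C) (monomials n d).
have -> : count (predI (term_lt^~ C) (pred1 C)) (monomials n d) = 0%N.
  by rewrite (@eq_count _ _ pred0) ?count_pred0 // => A /=;
     case: eqP => [->|]; rewrite /term_lt ?eqxx ?andbF.
have : (0 < count (pred1 C) (monomials n d))%N.
  by rewrite -has_count has_pred1 mem_monomials Cd.
have : (count (predU (term_lt^~ C) (pred1 C)) (monomials n d) <=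
        count (term_lt^~ B) (monomials n d))%N.
  apply: sub_count => A /= /orP[ltAC|/eqP->//].
  exact: term_lt_le_trans ltAC (term_ltW CB).
move=> le_B C_gt0; rewrite addn0 => cU.
by rewrite (leq_trans _ le_B) // cU -addn1 leq_add2l.
Qed.

End TermOrders.

(** * Borel moves between divisors of a monomial *)

Lemma exists_lt_exponent n (A B : 'X_{1..n}) :
  mdeg A = mdeg B -> A <> B -> exists i, (A i < B i)%N.
Proof.
move=> degAB neAB.
case: (pickP (fun i => A i < B i)%N) => [i ltAB|geAB]; first by exists i.
have leBA : (B <= A)%MM.
  by apply/mnm_lepP => i; rewrite leqNgt geAB.
have := submK leBA; have /eqP := congr1 mdeg (submK leBA).
rewrite mdegD degAB -{2}[mdeg B]add0n eqn_add2r mdeg_eq0 => /eqP-> B_A.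
by case: neAB; rewrite -B_A add0m.
Qed.

Lemma submU n (A : 'X_{1..n}) i : (0 < A i)%N -> (A - U_(i) + U_(i))%MM = A.
Proof. by rewrite lt0n -lep1mP; exact: submK. Qed.

Section LightestDivisors.
Variables (n : nat) (P : pred 'X_{1..n.+1}) (m : nat).
Local Notation mon := 'X_{1..n.+1}.
Hypothesis P_gen : forall C, P C -> (m <= mdeg C)%N ->
  exists A, [/\ P A, mdeg A = m & (A <= C)%MM].
Hypothesis P_Borel : forall (A : mon) (j k : 'I_n.+1), (j < k)%N ->
  P (A + U_(k))%MM -> P (A + U_(j))%MM.

Definition divisors C : seq mon := [seq A <- monomials n m | P A & (A <= C)%MM].

Lemma mem_divisors C A :
  (A \in divisors C) = [&& P A, (A <= C)%MM & mdeg A == m].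
Proof. by rewrite mem_filter mem_monomials -andbA. Qed.

(** [mnmwgt] counts the variable [x_i] with weight [i + 1].  On monomials of fixed
degree this differs by a constant from the sum of the indices, and a Borel move
decreases it strictly. *)
Definition lightest_divisor C : mon :=
  head 0%MM (sort (relpre (@mnmwgt _) leq) (divisors C)).

Lemma lightest_divisorP C : P C -> (m <= mdeg C)%N ->
  lightest_divisor C \in divisors C /\
  forall A, A \in divisors C -> (mnmwgt (lightest_divisor C) <= mnmwgt A)%N.
Proof.
move=> PC mC; rewrite /lightest_divisor; set s := sort _ _.
have memE A : (A \in divisors C) = (A \in s) by rewrite mem_sort.
have: sorted (relpre (@mnmwgt _) leq) s.
  by apply: sort_sorted => A B; exact: leq_total.
have [A0 [PA0 A0m A0C]] := P_gen PC mC.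
have: A0 \in s by rewrite -memE mem_divisors PA0 A0C A0m /=.
case: s memE => // H s memE _ /= path_s; split; first by rewrite memE mem_head.
move=> A; rewrite memE inE => /orP[/eqP->//|].
by apply/allP: A; apply: order_path_min path_s => ? ? ?; exact: leq_trans.
Qed.

(** A divisor [A] and the lightest one [H] have the same degree, so some [x_i]
occurs more often in [H] and some [x_k] more often in [A].  If [k < i], trading
[x_i] for [x_k] in [H] would give a lighter divisor; hence [i < k], and the Borel
move trades [x_k] for [x_i] in [A], with [x_i A] still a divisor of [C]. *)
Lemma Borel_swap C A : P C -> A \in divisors C -> A != lightest_divisor C ->
  exists A0 (j k : 'I_n.+1), [/\ (j < k)%N, A = (A0 + U_(k))%MM,
    P (A0 + U_(j))%MM & (A0 + U_(j) + U_(k) <= C)%MM].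
Proof.
move=> PC Adiv neAH.
have swap B i k : B \in divisors C -> (B i < C i)%N -> (0 < B k)%N -> (i < k)%N ->
    [/\ B = (B - U_(k) + U_(k))%MM, P (B - U_(k) + U_(i))%MM
      & (B - U_(k) + U_(i) + U_(k) <= C)%MM].
  rewrite mem_divisors => /and3P[PB /mnm_lepP BC _] BCi Bk ik.
  have BE := submU Bk.
  split; [by rewrite BE|by apply: P_Borel ik _; rewrite BE|].
  have -> : (B - U_(k) + U_(i) + U_(k) = B + U_(i))%MM.
    by rewrite -{2}BE -!addmA [(U_(i) + _)%MM]addmC.
  apply/mnm_lepP => l; rewrite mnmDE mnm1E.
  by case: eqP => [<-|_]; rewrite ?addn1 ?addn0.
have /and3P[PA leAC /eqP Am] : [&& P A, (A <= C)%MM & mdeg A == m].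
  by rewrite -mem_divisors.
have mC : (m <= mdeg C)%N by rewrite -Am -(submK leAC) mdegD leq_addl.
have [Hdiv Hmin] := lightest_divisorP PC mC; move: neAH Hdiv Hmin.
set H := lightest_divisor C => /eqP neAH Hdiv Hmin.
have /and3P[PH HC /eqP Hm] : [&& P H, (H <= C)%MM & mdeg H == m].
  by rewrite -mem_divisors.
have [i AHi] : exists i, (A i < H i)%N.
  by apply: exists_lt_exponent => //; rewrite Am Hm.
have [k HAk] : exists k, (H k < A k)%N.
  by apply: exists_lt_exponent; [rewrite Am Hm|move=> HA; apply: neAH].
have [ik|ki|/val_inj ik] := ltngtP i k; last by move: AHi HAk; rewrite ik; lia.
- have [||||AE PA' A'C] // := swap A i k.
  + exact: leq_trans AHi (mnm_lepP HC i).
  + exact: leq_ltn_trans HAk.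
  by exists (A - U_(k))%MM, i, k.
have [||||HE PH' H'C] // := swap H k i.
- exact: leq_trans HAk (mnm_lepP leAC k).
- exact: leq_ltn_trans AHi.
have /Hmin : (H - U_(i) + U_(k))%MM \in divisors C.
  rewrite mem_divisors PH' (lepm_trans _ H'C) ?lem_addr //=.
  by move: Hm; rewrite {1}HE !mdegD !mdeg1 => ->.
by rewrite {1}HE !mnmwgtD !mnmwgt1 leq_add2l ltnS leqNgt ki.
Qed.

End LightestDivisors.

(** * Rewriting by a basis with prescribed leading monomials *)

Lemma subspace_ideal_ideal (K : fieldType) n d
    (V : {vspace dhomog n.+1 K d}) : ideal (subspace_ideal V).
Proof. exact: ideal_gen_ideal. Qed.

(** [P] stands for the monomials of a Borel-fixed ideal generated in degrees at
most [m], and [F A] for the element with leading monomial [A] in a basis of [V]. *)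
Section MarkedBasis.
Variables (K : fieldType) (n : nat) (le : rel 'X_{1..n.+1}).
Local Notation S := {mpoly K[n.+1]}.
Local Notation mon := 'X_{1..n.+1}.
Local Notation "A <t B" := (term_lt le A B) (at level 70).
Variables (P : pred mon) (m : nat) (F : mon -> dhomog n.+1 K m).
Variable V : {vspace dhomog n.+1 K m}.
Hypothesis le_ordering : term_ordering le.
Hypothesis P_up : forall A B, (A <= B)%MM -> P A -> P B.
Hypothesis P_gen : forall C, P C -> (m <= mdeg C)%N ->
  exists A, [/\ P A, mdeg A = m & (A <= C)%MM].
Hypothesis P_Borel : forall (A : mon) (j k : 'I_n.+1), (j < k)%N ->
  P (A + U_(k))%MM -> P (A + U_(j))%MM.
Hypothesis F_lead : forall A, P A -> mdeg A = m ->
  forall C, C \in msupp ((F A : S) - 'X_[A]) -> C <t A.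
Hypothesis F_V : forall A, P A -> mdeg A = m -> F A \in V.
Hypothesis V_F : (V <= <<[seq F A | A <- monomials n m & P A]>>)%VS.

Local Notation ldiv := (lightest_divisor P m).
Local Notation I_ z := (homog_part (subspace_ideal V) z).
Local Notation N_ z := (mon_space K (predC P) z).

Definition multiple z D A : dhomog n.+1 K z := homog_proj z ('X_[D] * (F A : S)).

(** One product for each monomial [C] of [P] that satisfies [Q], with leading
monomial [C]: the generators of this span are as many as those monomials, which
is what bounds the dimension of the ideal from above. *)
Definition reducers (Q : pred mon) z : {vspace dhomog n.+1 K z} :=
  <<[seq multiple z (C - ldiv C) (ldiv C) | C <- monomials n z & predI P Q C]>>.

Lemma multiple_homog D A : ('X_[D] * (F A : S)) \is (mdeg D + m).-homog.
Proof. by apply: dhomogM; [rewrite dhomogX | exact: dhomog_is_dhomog]. Qed.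

Lemma multipleE z D A : (mdeg D + m = z)%N ->
  multiple z D A = 'X_[D] * (F A : S) :> S.
Proof. by move=> <-; rewrite homog_projE // multiple_homog. Qed.

Lemma multiple_eq0 z D A : (mdeg D + m)%N != z -> multiple z D A = 0.
Proof. exact: homog_proj_neq (multiple_homog D A). Qed.

Lemma multiple_ideal z D A : P A -> mdeg A = m -> multiple z D A \in I_ z.
Proof.
move=> PA Am; have idI := subspace_ideal_ideal V.
have [Dz|/multiple_eq0->] := eqVneq (mdeg D + m)%N z; last exact: mem0v.
apply/(homog_partP idI); rewrite multipleE //.
case: idI => _ _; apply; exists [:: (1, F A : S)]; rewrite big_seq1 mul1r.
by split=> // p; rewrite inE => /eqP-> /=; exists (F A) => //; apply: F_V.
Qed.

Lemma lightest_divisor_spec C : P C -> (m <= mdeg C)%N ->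
  [/\ P (ldiv C), mdeg (ldiv C) = m & (ldiv C <= C)%MM].
Proof.
move=> PC mC; have [] := lightest_divisorP P_gen PC mC.
by rewrite mem_divisors => /and3P[? ? /eqP].
Qed.

Lemma reducers_sub_ideal Q z : (m <= z)%N -> (reducers Q z <= I_ z)%VS.
Proof.
move=> mz; apply/span_subvP => _ /mapP[C + ->].
rewrite mem_filter mem_monomials => /andP[/andP[PC _] /eqP Cz].
have [] := lightest_divisor_spec PC; rewrite ?Cz // => PH Hm _.
exact: multiple_ideal.
Qed.

Lemma multiple_lead D A : P A -> mdeg A = m ->
  forall C, C \in msupp ('X_[D] * (F A : S) - 'X_[D + A]) -> C <t (D + A)%MM.
Proof.
move=> PA Am C; rewrite mpolyXD -mulrBr mulrC (perm_mem (msuppMX _ _)).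
case/mapP=> B BF ->; rewrite ![(D + _)%MM]addmC.
exact/(term_ltD2r le_ordering)/F_lead.
Qed.

(** Subtracting from [B] the product with leading monomial [B] leaves smaller
monomials, to which induction applies.  The downward closed [Q] keeps track of
the size of the leading monomials used. *)
Lemma reduction (Q : pred mon) z : (m <= z)%N ->
  (forall B C, B <t C -> Q C -> Q B) ->
  forall B, mdeg B = z -> Q B -> homog_proj z 'X_[B] \in (reducers Q z + N_ z)%VS.
Proof.
move=> mz Qdown; apply: (term_lt_ind le_ordering) => B Bz IH QB.
have [PB|PB] := boolP (P B); last first.
  by apply: (subvP (addvSr _ _)); apply: mem_mon_space.
have [|PH Hm HB] := lightest_divisor_spec PB; first by rewrite Bz.
have degB : (mdeg (B - ldiv B) + m = z)%N
  by rewrite -Bz -[in RHS](submK HB) mdegD Hm.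
have -> : homog_proj z 'X_[B] = multiple z (B - ldiv B) (ldiv B)
    - homog_proj z ('X_[B - ldiv B] * (F (ldiv B) : S) - 'X_[B]) :> dhomog _ _ _.
  by rewrite linearB /= opprB addrC subrK.
apply: rpredB.
  apply: (subvP (addvSl _ _)); apply/memv_span/map_f.
  by rewrite mem_filter /= PB QB mem_monomials Bz eqxx.
apply: memv_homog_proj => C CB Cz.
have CltB : C <t B.
  by have := multiple_lead (D := (B - ldiv B)%MM) PH Hm (C := C);
     rewrite submK //; apply.
by apply: IH => //; apply: Qdown CltB QB.
Qed.

Lemma ideal_add_mon_space z : (m <= z)%N -> (I_ z + N_ z = fullv)%VS.
Proof.
move=> mz; apply/eqP; rewrite eqEsubv subvf; apply/subvP => w _.
rewrite -[w]homog_proj_id; apply: memv_homog_proj => C _ Cz.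
apply: (subvP (addvS (reducers_sub_ideal predT mz) (subvv _))).
exact: reduction.
Qed.

Section LinearSyzygies.
Hypothesis dim_linear : \dim (I_ m.+1) = count P (monomials n m.+1).

(** Both products have leading term [M], which cancels in the difference.  The
reduction of the difference has its remainder in the ideal and in the span of
the monomials outside [P], and in degree [m + 1] these meet trivially. *)
Lemma linear_syzygy A (j k : 'I_n.+1) : mdeg (A + U_(k))%MM = m ->
  P (A + U_(j))%MM -> P (A + U_(k))%MM ->
  multiple m.+1 U_(j) (A + U_(k)) - multiple m.+1 U_(k) (A + U_(j)) \in
    reducers (term_lt le ^~ (A + U_(j) + U_(k))%MM) m.+1.
Proof.
move=> degA PAj PAk; set M := (A + U_(j) + U_(k))%MM.
have degAj : mdeg (A + U_(j))%MM = m by move: degA; rewrite !mdegD !mdeg1.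
have eqMj : (U_(j) + (A + U_(k)) = M)%MM.
  by rewrite /M addmA [(U_(j) + A)%MM]addmC.
have eqMk : (U_(k) + (A + U_(j)) = M)%MM by rewrite addmC.
set e := _ - _.
have e_ideal : e \in I_ m.+1 by apply: rpredB; exact: multiple_ideal.
have: e \in (reducers (term_lt le ^~ M) m.+1 + N_ m.+1)%VS.
  have -> : e = homog_proj m.+1 (('X_[U_(j)] * (F (A + U_(k)) : S) - 'X_[M])
                              - ('X_[U_(k)] * (F (A + U_(j)) : S) - 'X_[M])).
    by rewrite !linearB /= opprK addrA addrAC subrK.
  apply: memv_homog_proj => C /msuppB_le; rewrite mem_cat => Csupp Cdeg.
  apply: reduction => //; first by move=> B D BD /term_ltW; exact: term_lt_le_trans.
  case/orP: Csupp; first by rewrite -eqMj; exact: multiple_lead.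
  by rewrite -eqMk; exact: multiple_lead.
case/memv_addP => g gR [r rN eE].
suff r0 : r = 0 by rewrite eE r0 addr0.
have [_ /(_ dim_linear) cap0] := dim_add_mon_spaceC (ideal_add_mon_space (leqnSn m)).
apply/eqP; rewrite -memv0 -cap0 memv_cap rN andbT.
have -> : r = e - g by rewrite eE addrC addKr.
by rewrite rpredB // (subvP (reducers_sub_ideal _ (leqnSn m)) _ gR).
Qed.

(** If [A] is the lightest divisor of [M] the product is one of the generators.
Otherwise a Borel move leads to a lighter divisor [A'], and the two products with
leading monomial [M] differ by a multiple of a linear syzygy, whose terms have
leading monomials below [M]. *)
Lemma multiple_reducible z M : mdeg M = z ->
  forall A, P A -> mdeg A = m -> (A <= M)%MM ->
  multiple z (M - A) A \in reducers predT z.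
Proof.
move: M; apply: (term_lt_ind le_ordering) => M Mz IH A.
have [w] := ubnP (mnmwgt A); elim: w A => // w IHw A Aw PA Am AM.
have PM : P M by apply: P_up PA.
have mM : (m <= mdeg M)%N by rewrite -Am -(submK AM) mdegD leq_addl.
have [->|neAH] := eqVneq A (ldiv M).
  apply/memv_span/map_f.
  by rewrite mem_filter /= PM mem_monomials Mz eqxx.
have Adiv : A \in divisors P m M by rewrite mem_divisors PA AM Am eqxx.
have [A0 [j [k [jk eqA PA' A'M]]]] := Borel_swap P_gen P_Borel PM Adiv neAH.
subst A; set A' := (A0 + U_(j))%MM; set A := (A0 + U_(k))%MM.
have A'm : mdeg A' = m by move: Am; rewrite !mdegD !mdeg1.
pose D := (M - (A' + U_(k)))%MM.
have ME : (D + (A' + U_(k)) = M)%MM by rewrite submK.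
have MA : (M - A = D + U_(j))%MM.
  apply: (@addIm _ A); rewrite submK // -ME /A /A'; move: {ME} D => D.
  by apply/mnmP => i; rewrite !mnmDE -!addnA; congr (_ + _)%N; rewrite addnCA.
have MA' : (M - A' = D + U_(k))%MM.
  apply: (@addIm _ A'); rewrite submK.
    by rewrite -ME -addmA [(U_(k) + _)%MM]addmC.
  exact: lepm_trans (lem_addr _ _) A'M.
have degD : (mdeg D + m.+1 = z)%N
  by rewrite -Mz -ME mdegD (mdegD A') mdeg1 A'm addn1.
pose e := multiple m.+1 U_(j) A - multiple m.+1 U_(k) A'.
have -> : multiple z (M - A) A =
    homog_proj z ('X_[D] * (e : S)) + multiple z (M - A') A'.
  rewrite /multiple MA MA' -linearD; congr homog_proj.
  have -> : e = 'X_[U_(j)] * (F A : S) - 'X_[U_(k)] * (F A' : S) :> S.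
    by rewrite linearB; congr (_ - _); apply: multipleE; rewrite mdeg1.
  by rewrite !mpolyXD mulrBr !mulrA subrK.
apply: rpredD; last first.
  apply: IHw => //; last exact: lepm_trans (lem_addr _ _) A'M.
  by move: Aw; rewrite /A /A' !mnmwgtD !mnmwgt1 ltnS; apply: leq_trans;
     rewrite ltn_add2l.
have := linear_syzygy Am PA' PA; rewrite -/e; move: e.
apply: span_ind => [|a u v IHu IHv|_ /mapP[C + ->]].
- by rewrite mulr0 linear0 mem0v.
- rewrite mulrDr -scalerAr linearD linearZ /=.
  by rewrite rpredD // rpredZ.
rewrite mem_filter mem_monomials => /andP[/andP[PC CM] /eqP Cm].
have [|PH Hm HC] := lightest_divisor_spec PC; first by rewrite Cm.
have degC : (mdeg (C - ldiv C) + m = m.+1)%N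
  by rewrite -Cm -[in RHS](submK HC) mdegD Hm.
have HDC : (ldiv C <= D + C)%MM by apply: lepm_trans HC _; exact: lem_addl.
rewrite multipleE // mulrA -mpolyXD addmBA //.
apply: IH => //; first by rewrite mdegD Cm.
by rewrite -ME ![(D + _)%MM]addmC; exact: term_ltD2r.
Qed.

Lemma ideal_sub_reducers z : (I_ z <= reducers predT z)%VS.
Proof.
apply/subvP => w /(homog_partP (subspace_ideal_ideal V)) [s [sV wE]].
rewrite -[w]homog_proj_id wE linear_sum big_seq rpred_sum //= => p /sV[v vV ->].
move: v vV => v /(subvP V_F); move: v.
apply: span_ind => [|a u v IHu IHv|_ /mapP[A + ->]].
- by rewrite mulr0 linear0 mem0v.
- by rewrite mulrDr -scalerAr linearD linearZ /= rpredD // rpredZ.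
rewrite mem_filter mem_monomials => /andP[PA /eqP Am].
rewrite [p.1]mpolyE mulr_suml linear_sum rpred_sum //= => D _.
rewrite -scalerAl linearZ rpredZ //=.
have [Dz|/(multiple_eq0 A)] := eqVneq (mdeg D + m)%N z; last first.
  by rewrite /multiple => ->; exact: mem0v.
have := @multiple_reducible z (D + A) _ A PA Am (lem_addl _ _).
by rewrite addmK; apply; rewrite mdegD Am.
Qed.

Lemma dim_ideal z : (m <= z)%N -> \dim (I_ z) = count P (monomials n z).
Proof.
move=> mz; apply/eqP; rewrite eqn_leq.
have [-> _] := dim_add_mon_spaceC (ideal_add_mon_space mz); rewrite andbT.
apply: leq_trans (dimvS (ideal_sub_reducers z)) _.
apply: leq_trans (dim_span_monomials _ _) _.
by apply: sub_count => C /andP[].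
Qed.

End LinearSyzygies.
End MarkedBasis.

(** * The reduced basis of a subspace in the chart *)

(** Multiplying a basis of [V] by the inverse of the minor on the columns [s]
makes that minor the identity matrix. *)
Lemma chart_basis (K : fieldType) n d (V : {vspace dhomog n.+1 K d})
    (s : (\dim V).-tuple 'X_{1..n.+1}) : uniq s -> plucker s != 0 ->
  exists F : 'X_{1..n.+1} -> dhomog n.+1 K d,
    [/\ forall A, A \in s -> F A \in V,
        forall A B, A \in s -> B \in s ->
          (F A : {mpoly K[n.+1]})@_B = (A == B)%:R
      & (V <= <<[seq F A | A <- s]>>)%VS].
Proof.
rewrite /plucker; set M := (\matrix_(i, j) _) => Us detM.
have unitM : M \in unitmx by rewrite unitmxE unitfE.
pose b i := tnth (vbasis V) i.
pose G j := \sum_i invmx M j i *: b i.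
(* The sum has one term when [A] belongs to [s], and none otherwise. *)
pose F A := \sum_(j | tnth s j == A) G j.
have FE j : F (tnth s j) = G j.
  rewrite /F (big_pred1 j) // => l; apply/eqP/eqP => [|->//].
  by move: Us => /tuple_uniqP; exact.
have bV i : b i \in V by apply/vbasis_mem/mem_tnth.
exists F; split.
- by move=> _ /tnthP[j ->]; rewrite FE rpred_sum // => i _; rewrite rpredZ.
- move=> _ _ /tnthP[j ->] /tnthP[l ->]; rewrite FE linear_sum raddf_sum /=.
  have := congr1 (fun N : 'M_ _ => N j l) (mulVmx unitM); rewrite !mxE => MV.
  rewrite (inj_eq (tuple_uniqP _ Us)) -MV; apply: eq_bigr => i _.
  by rewrite linearZ mxE.
rewrite -{1}(span_basis (vbasisP V)); apply/span_subvP => _ /tnthP[i ->].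
have -> : tnth (vbasis V) i = \sum_j M i j *: F (tnth s j).
  under eq_bigr do rewrite FE scaler_sumr.
  rewrite exchange_big /=.
  under eq_bigr => l _.
    under eq_bigr do rewrite scalerA.
    rewrite -scaler_suml.
    have := congr1 (fun N : 'M_ _ => N i l) (mulmxV unitM); rewrite !mxE => ->.
    over.
  rewrite /= (bigD1 i) //= eqxx scale1r big1 ?addr0 // => l li.
  by rewrite eq_sym (negbTE li) scale0r.
by apply: rpred_sum => j _; apply/rpredZ/memv_span/map_f/mem_tnth.
Qed.

(** * Monomials of a Borel-fixed ideal *)

Section MonomialIdeals.
Variables (K : fieldType) (n : nat).
Local Notation S := {mpoly K[n.+1]}.
Local Notation mon := 'X_{1..n.+1}.
Variable J : S -> Prop.

Definition mon_in : pred mon := fun A =>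
  if excluded_middle_informative (J 'X_[A]) then true else false.

Lemma mon_inP A : reflect (J 'X_[A]) (mon_in A).
Proof. by rewrite /mon_in; case: excluded_middle_informative => ?; constructor. Qed.

Lemma mon_generators_supp M : mon_generators J M ->
  forall f, J f -> forall C, C \in msupp f -> exists2 A, M A & (A <= C)%MM.
Proof.
move=> JM f /JM[s [sM ->]] C; rewrite big_seq.
move/msupp_sum_le/flattenP => [_ /mapP[p + ->]].
rewrite mem_filter => /andP[/sM[A MA ->] _].
rewrite (perm_mem (msuppMX _ _)) => /mapP[B _ ->].
by exists A => //; exact: lem_addr.
Qed.

Lemma ideal_mon_up : ideal J -> forall A B, (A <= B)%MM -> mon_in A -> mon_in B.
Proof.
move=> [_ _ JM] A B AB /mon_inP JA; apply/mon_inP.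
by rewrite -(submK AB) mpolyXD; exact: JM.
Qed.

Lemma monomial_ideal_homog_part d : monomial_ideal J ->
  homog_part J d = mon_space K mon_in d.
Proof.
move=> [M JM]; have idJ := mon_generators_ideal JM.
have JX A : M A -> mon_in A.
  move=> MA; apply/mon_inP/JM; exists [:: (1, 'X_[A])]; rewrite big_seq1 mul1r.
  by split=> // p; rewrite inE => /eqP->; exists A.
apply/eqP; rewrite eqEsubv; apply/andP; split.
  apply/subvP => w /(homog_partP idJ) Jw.
  rewrite -[w]homog_proj_id; apply: memv_homog_proj => C Cw Cd.
  apply: mem_mon_space => //.
  have [A /JX JA leAC] := mon_generators_supp JM Jw Cw.
  exact: ideal_mon_up leAC JA.
apply/span_subvP => _ /mapP[C + ->].
rewrite mem_filter mem_monomials => /andP[/mon_inP JC Cd].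
by apply/(homog_partP idJ); rewrite homog_projE ?dhomogX.
Qed.

Lemma divisor_of_degree d (A C : mon) : (A <= C)%MM -> (mdeg A <= d <= mdeg C)%N ->
  exists B, [/\ (A <= B)%MM, (B <= C)%MM & mdeg B = d].
Proof.
move=> leAC /andP[]; elim: d => [|d IHd] Ad dC.
  by exists A; split=> //; [exact: lepm_refl | apply/eqP; rewrite -leqn0].
have [AdE|neAd] := eqVneq (mdeg A) d.+1.
  by exists A; split=> //; exact: lepm_refl.
have [||B [AB BC Bd]] := IHd; [by rewrite -ltnS ltn_neqAle neAd | exact: ltnW |].
have [i Bi] : exists i, (B i < C i)%N.
  case: (pickP (fun i => B i < C i)%N) => [i|CB]; first by exists i.
  suff CB' : (C <= B)%MM by have := congr1 mdeg (submK CB'); rewrite mdegD; lia.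
  by apply/mnm_lepP => i; rewrite leqNgt CB.
exists (B + U_(i))%MM; split; last by rewrite mdegD mdeg1 Bd addn1.
  exact: lepm_trans AB (lem_addr _ _).
apply/mnm_lepP => l; rewrite mnmDE mnm1E.
by case: eqP => [<-|_]; rewrite ?addn1 ?addn0 //; exact: (mnm_lepP BC).
Qed.

(** [C] is a multiple of a minimal generator, whose degree is at most [m], and the
divisors of [C] between the two have all intermediate degrees. *)
Lemma max_gen_degree_divisor m : max_gen_degree J m ->
  forall C, mon_in C -> (m <= mdeg C)%N ->
  exists A, [/\ mon_in A, mdeg A = m & (A <= C)%MM].
Proof.
move=> [[A0 [M minM MA0] _] degM] C /mon_inP JC mC; have [JM _] := minM.
have Csupp : C \in msupp ('X_[C] : S) by rewrite msuppX mem_head.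
have [A MA leAC] := mon_generators_supp JM JC Csupp.
have Am : (mdeg A <= m)%N by apply: degM; exists M.
have [|B [AB BC Bm]] := @divisor_of_degree m A C leAC; first by rewrite Am mC.
exists B; split=> //; apply: (ideal_mon_up (mon_generators_ideal JM) AB).
apply/mon_inP/JM; exists [:: (1, 'X_[A])]; rewrite big_seq1 mul1r.
by split=> // p; rewrite inE => /eqP->; exists A.
Qed.

Lemma Borel_fixed_moves : Borel_fixed J ->
  forall (A : mon) (j k : 'I_n.+1), (j < k)%N ->
  mon_in (A + U_(k))%MM -> mon_in (A + U_(j))%MM.
Proof.
move=> [_ step] A j k jk.
have [d] : exists d, nat_of_ord k = (j + d)%N by exists (k - j)%N; lia.
elim: d k {jk} => [|d IHd] k.
  by rewrite addn0 => /val_inj->.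
rewrite addnS => kE /mon_inP Jk.
have lt_jd : (j + d < n.+1)%N by have := ltn_ord k; lia.
apply: (IHd (Ordinal lt_jd)) => //; apply/mon_inP.
by move: Jk; rewrite ![(A + _)%MM]addmC !mpolyXD; exact: step.
Qed.

End MonomialIdeals.

(** * Persistence of the dimension *)

Theorem theorem4 (K : closedFieldType) (charK : [pchar K] =i pred0) (n : nat)
    (le : rel 'X_{1..n.+1}) (le_ordering : term_ordering le)
    (J : {mpoly K[n.+1]} -> Prop) (m : nat) (J_extremal : extremal le J m)
    (V : {vspace dhomog n.+1 K m}) (dimV : \dim V = \dim (homog_part J m))
    (V_chart : in_chart J V) :
  \dim (homog_part (subspace_ideal V) m.+1) = \dim (homog_part J m.+1) <->
  (forall z : nat, (m <= z)%N ->
     \dim (homog_part (subspace_ideal V) z) = \dim (homog_part J z)).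
Proof.
case: J_extremal => BorelJ genJ lt_compl.
have [[M JM] _] := BorelJ.
have dimJ z : \dim (homog_part J z) = count (mon_in J) (monomials n z).
  by rewrite monomial_ideal_homog_part ?dim_mon_space //; exists M.
split=> [dim_linear z mz|]; last by apply; exact: leqnSn.
have [s [Us sJ minor]] := V_chart.
have memE A : (A \in s) = mon_in J A && (mdeg A == m).
  by apply/idP/andP => [/sJ[/eqP Am /mon_inP JA]|[/mon_inP JA /eqP Am]] //; apply/sJ.
have [F [FV Fdual VF]] := chart_basis Us minor.
rewrite dimJ; apply: (@dim_ideal _ _ le (mon_in J) m F V) => //.
- exact/ideal_mon_up/(mon_generators_ideal JM).
- exact: max_gen_degree_divisor.
- exact: Borel_fixed_moves.
- move=> A JA Am C CF.
  have As : A \in s by rewrite memE JA Am eqxx.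
  have degC : mdeg C = m.
    apply: (@dhomog_mf _ _ mdeg m _ _ C CF).
    by apply: rpredB; [exact: dhomog_is_dhomog | rewrite dhomogX; apply/eqP].
  apply: lt_compl => //; first exact/mon_inP.
  move=> JC; move: CF; rewrite mcoeff_msupp mcoeffB mcoeffX Fdual ?subrr ?eqxx //.
  by apply/sJ.
- by move=> A JA Am; apply: FV; rewrite memE JA Am eqxx.
- apply: subv_trans VF _; apply: sub_span => _ /mapP[A + ->].
  by rewrite memE => /andP[JA Am]; apply/map_f; rewrite mem_filter JA mem_monomials.
- by rewrite dim_linear dimJ.
Qed.
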